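(* There exists no primitive formally dual set of rank two in any finite abelian group.
   Context: For a finite abelian group $G$ and a group isomorphism $\Delta:G\to\widehat G$, $y\mapsto\chi_y$, subsets $S,T\subseteq G$ form a formally dual pair if for all $y\in G$: $|\chi_y(S)|^2=\frac{|S|^2}{|T|}\nu_T(y)$ and $|\chi_y(T)|^2=\frac{|T|^2}{|S|}\nu_S(y)$, where $\chi(A)=\sum_{a\in A}\chi(a)$ and $\nu_A(y)=|\{(a_1,a_2)\in A\times A\mid y=a_1a_2^{-1}\}|$. A subset is primitive if it is not contained in a coset of a proper subgroup and is not a union of cosets of a nontrivial subgroup; $S$ is a primitive formally dual set if there exist such $\Delta$ and $T$ with both $S$ and $T$ primitive. $S$ is an even set if, in the group ring $\mathbb{Z}[G]$, $SS^{(-1)}=\sum_{i=1}^r\lambda_iH_i$ for some subgroups $H_i$ (identified with the sum of their elements) and nonzero integers $\lambda_i$, where $S^{(-1)}=\sum_{s\in S}s^{-1}$; its rank is the smallest such $r$. *)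

(* Defs.v *)
From HB Require Import structures.
From mathcomp Require Import all_boot all_order all_algebra all_fingroup.
From mathcomp Require Import all_solvable all_field all_character.

Set Implicit Arguments.
Unset Strict Implicit.
Unset Printing Implicit Defensive.

Import Order.TTheory GRing.Theory Num.Theory GroupScope.
Local Open Scope ring_scope.

Section IntegralGroupRing.

Variable gT : finGroupType.

(* The integral group ring of the whole type gT; for G : {group gT}, Z[G] is  *)
(* the subring of the elements supported in G. The alias hides the pointwise  *)
(* product of finite functions: here the product is convolution.              *)
Definition Zgring : Type := {ffun gT -> int}.
HB.instance Definition _ := GRing.Zmodule.on Zgring.

Implicit Types a b c : Zgring.

Definition Zgr_elt (g : gT) : Zgring := [ffun x => (x == g)%:R].
Definition Zgr_mul a b : Zgring := [ffun g => \sum_x a x * b (x^-1 * g)%g].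

Fact Zgr_mulA : associative Zgr_mul.
Proof.
move=> a b c; apply/ffunP=> g; rewrite !ffunE.
under eq_bigr => x _ do rewrite ffunE mulr_sumr.
under [RHS]eq_bigr => x _ do rewrite ffunE mulr_suml.
rewrite [RHS]exchange_big /=; apply: eq_bigr => x _.
rewrite [RHS](reindex_inj (mulgI x)); apply: eq_bigr => y _ /=.
by rewrite mulKg invMg mulrA mulgA.
Qed.

Fact Zgr_mul1 : left_id (Zgr_elt 1) Zgr_mul.
Proof.
move=> a; apply/ffunP=> g; rewrite ffunE (bigD1 1%g) //= big1 => [|x nx1].
  by rewrite ffunE eqxx mul1r invg1 mul1g addr0.
by rewrite ffunE (negPf nx1) mul0r.
Qed.

Fact Zgr_mulr1 : right_id (Zgr_elt 1) Zgr_mul.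
Proof.
move=> a; apply/ffunP=> g; rewrite ffunE (bigD1 g) //= big1 => [|x nxg].
  by rewrite ffunE mulVg eqxx mulr1 addr0.
by rewrite ffunE -eq_mulVg1 (negPf nxg) mulr0.
Qed.

Fact Zgr_mulDl : left_distributive Zgr_mul +%R.
Proof.
move=> a b c; apply/ffunP=> g; rewrite !ffunE -big_split /=.
by apply: eq_bigr => x _; rewrite ffunE mulrDl.
Qed.

Fact Zgr_mulDr : right_distributive Zgr_mul +%R.
Proof.
move=> a b c; apply/ffunP=> g; rewrite !ffunE -big_split /=.
by apply: eq_bigr => x _; rewrite ffunE mulrDr.
Qed.

Fact Zgr_nontrivial : Zgr_elt 1 != 0.
Proof. by apply/eqP=> /ffunP/(_ 1%g); rewrite !ffunE eqxx. Qed.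

HB.instance Definition _ := GRing.Zmodule_isNzRing.Build Zgring
  Zgr_mulA Zgr_mul1 Zgr_mulr1 Zgr_mulDl Zgr_mulDr Zgr_nontrivial.

Lemma Zgr_eltM x y : Zgr_elt (x * y)%g = Zgr_elt x * Zgr_elt y.
Proof.
apply/ffunP=> g; rewrite [RHS]ffunE (bigD1 x) //= big1 => [|z nzx].
  by rewrite !ffunE eqxx mul1r addr0 -(inj_eq (mulgI x) (x^-1 * g)%g) mulKVg.
by rewrite ffunE (negPf nzx) mul0r.
Qed.

Definition Zgr_set (A : {set gT}) : Zgring := \sum_(g in A) Zgr_elt g.

Definition Zgr_setV (A : {set gT}) : Zgring := \sum_(g in A) Zgr_elt g^-1.

End IntegralGroupRing.

Section FormalDuality.

Variables (gT : finGroupType) (G : {group gT}).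

Implicit Types (S T A : {set gT}) (Delta : gT -> 'CF(G)).

(* For abelian G the character group of G is the set of linear characters of  *)
(* G under the pointwise product, which is the ring product of 'CF(G). The    *)
(* values of Delta outside G are irrelevant.                                  *)
Definition dual_isom Delta : Prop :=
  [/\ {in G, forall y, Delta y \is a linear_char},
      {in G &, {morph Delta : x y / (x * y)%g >-> x * y}},
      {in G &, injective Delta}
    & forall chi : 'CF(G), chi \is a linear_char ->
        exists2 y, y \in G & Delta y = chi].

Definition char_sum (chi : 'CF(G)) A : algC := \sum_(a in A) chi a.

Definition weight A (y : gT) : nat :=
  #|[set p in setX A A | y == (p.1 * p.2^-1)%g]|.

(* No nonemptiness condition is needed: as division by 0 yields 0, the two    *)
(* equations at y = 1 exclude that exactly one of S and T is empty.           *)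
Definition formally_dual_pair Delta S T : Prop :=
  [/\ S \subset G, T \subset G
    & {in G, forall y,
        `|char_sum (Delta y) S| ^+ 2
          = #|S|%:R ^+ 2 / #|T|%:R * (weight T y)%:R
     /\ `|char_sum (Delta y) T| ^+ 2
          = #|T|%:R ^+ 2 / #|S|%:R * (weight S y)%:R}].

Definition in_proper_coset A : Prop :=
  exists H : {group gT}, H \proper G /\
    exists2 C, C \in rcosets H G & A \subset C.

Definition union_of_cosets A : Prop :=
  exists N : {group gT}, [/\ N \subset G, N :!=: 1%g &
    exists2 P : {set {set gT}}, P \subset rcosets N G & A = cover P].

Definition primitive_subset A : Prop :=
  [/\ A \subset G, ~ in_proper_coset A & ~ union_of_cosets A].

Definition primitive_formally_dual_set S : Prop :=
  exists Delta, exists T : {set gT},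
    [/\ dual_isom Delta, formally_dual_pair Delta S T,
        primitive_subset S & primitive_subset T].

Definition even_decomposition S (r : nat) : Prop :=
  exists (H : 'I_r -> {group gT}) (lambda : 'I_r -> int),
    [/\ forall i, H i \subset G,
        forall i, lambda i != 0
      & Zgr_set S * Zgr_setV S = \sum_(i < r) Zgr_set (H i) *~ lambda i].

Definition even_set S : Prop :=
  S \subset G /\ exists r, even_decomposition S r.

Definition has_rank S (r : nat) : Prop :=
  even_decomposition S r /\ forall k, even_decomposition S k -> (r <= k)%N.

End FormalDuality.

(* Main.v *)
(* Write nu = nu_S = l1 [H1] + l2 [H2] with H1 <> H2. Evaluating nu at a point *)
(* of one subgroup outside the other, 0 <= nu <= nu(1) = l1 + l2 forces        *)
(* l1, l2 > 0. All quotients of elements of S lie in H1 or in H2, hence S lies *)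
(* in a single coset of H1 or of H2, and by primitivity that subgroup is G. On *)
(* the other subgroup nu is maximal, so S is stable under it and it is         *)
(* trivial. Thus S is a (v, k, l) difference set with 0 < l < k. Summing       *)
(* |chi_y(S)|^2 over y gives v = |S| |T| = k |T|, so k is prime to v - 1, and  *)
(* l (v - 1) = k (k - 1) would make k divide l.                                *)
Require Import Defs.
From mathcomp Require Import all_boot all_order all_algebra all_fingroup.
From mathcomp Require Import all_solvable all_field all_character.

Set Implicit Arguments.
Unset Strict Implicit.
Unset Printing Implicit Defensive.

Import Order.TTheory GRing.Theory Num.Theory GroupScope.
Local Open Scope ring_scope.

(** Comparing coefficients ([Zgr_set_mulV]) turns a rank-two decomposition into a formula for
    [weight S], and minimality of the rank makes the two subgroups distinct. Formal duality enters
    as the divisibility of [#|G|] by [#|S|] ([formally_dual_card]). Primitivity makes one subgroup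
    [G] ([no_weight_two_subgroups]) and the other trivial ([no_weight_group_plus_subgroup]); the
    resulting difference set is excluded by [no_divisible_difference_set]. *)

Section Weight.

Variable gT : finGroupType.
Implicit Types (A : {set gT}) (y : gT).

(** * Counting the quotients of a subset *)

Lemma weight_sum A y :
  weight A y = (\sum_(a in A) \sum_(b in A) (y == (a * b^-1)%g))%N.
Proof.
rewrite pair_big /weight -sum1_card /= [RHS]big_mkcond [LHS]big_mkcond /=.
apply: eq_bigr => -[a b] _; rewrite !inE /=.
by case: (a \in A) (b \in A) (y == _) => [] [] [].
Qed.

(** A pair with quotient [y] is determined by its second entry [b], the first being [y * b]. In this
    form the bound by [#|A|] and its equality case are visible. *)
Lemma weight_card A y : weight A y = #|[set b in A | (y * b)%g \in A]|.
Proof.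
rewrite weight_sum exchange_big /= -sum1_card.
rewrite [RHS]big_mkcond [LHS]big_mkcond /=; apply: eq_bigr => b _; rewrite inE.
case: (b \in A) => //=; rewrite big_mkcond (bigD1 (y * b)%g) //= big1 => [|a nya].
  by rewrite mulgK eqxx addn0.
case: ifP => // _; case: eqP => // ye; case/eqP: nya.
by rewrite ye mulgKV.
Qed.

Lemma weight_le A y : (weight A y <= #|A|)%N.
Proof.
by rewrite weight_card; apply/subset_leq_card/subsetP=> b; rewrite inE => /andP[].
Qed.

Lemma weight1 A : weight A 1 = #|A|.
Proof. by rewrite weight_card; apply: eq_card => b; rewrite inE mul1g andbb. Qed.

Lemma weight_max A y : weight A y = #|A| -> {in A, forall b, (y * b)%g \in A}.
Proof.
rewrite weight_card => eqA b Ab.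
have /eqP eA: [set b in A | (y * b)%g \in A] == A.
  by rewrite eqEcard eqA leqnn andbT; apply/subsetP=> c; rewrite inE => /andP[].
by move: Ab; rewrite -{1}eA inE => /andP[].
Qed.

Lemma weight_gt0 A a b : a \in A -> b \in A -> (0 < weight A (a * b^-1))%N.
Proof.
move=> Aa Ab; rewrite weight_card card_gt0; apply/set0Pn; exists b.
by rewrite inE Ab mulgKV Aa.
Qed.

Lemma sum_weight (G : {group gT}) A :
  A \subset G -> (\sum_(y in G) weight A y = #|A| ^ 2)%N.
Proof.
move=> sAG; under eq_bigr => y _ do rewrite weight_sum.
rewrite exchange_big /= -mulnn -sum_nat_const; apply: eq_bigr => a Aa.
rewrite exchange_big /= -sum1_card; apply: eq_bigr => b Ab.
rewrite (bigD1 (a * b^-1)%g) /= ?groupM ?groupV ?(subsetP sAG) //.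
by rewrite eqxx big1 // => y /andP[_ /negPf->].
Qed.

(** * Coefficients in the integral group ring *)

Lemma Zgr_sumE (I : Type) (r : seq I) (P : pred I) (F : I -> Zgring gT) y :
  (\sum_(i <- r | P i) F i) y = \sum_(i <- r | P i) F i y.
Proof.
by apply: (big_morph (fun f : Zgring gT => f y)) => [f g|]; rewrite !ffunE.
Qed.

Lemma Zgr_setE A y : Zgr_set A y = (y \in A)%:R.
Proof.
rewrite Zgr_sumE; under eq_bigr => g _ do rewrite ffunE.
have [Ay | nAy] := boolP (y \in A).
  rewrite (bigD1 y) //= eqxx big1 ?addr0 // => g /andP[_ nyg].
  by rewrite eq_sym (negPf nyg).
by rewrite big1 // => g Ag; case: eqP nAy => // ->; rewrite Ag.
Qed.

Lemma Zgr_set_mulV A y : (Zgr_set A * Zgr_setV A) y = (weight A y)%:R.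
Proof.
rewrite weight_sum mulr_suml Zgr_sumE natr_sum; apply: eq_bigr => a _.
rewrite mulr_sumr Zgr_sumE natr_sum; apply: eq_bigr => b _.
by rewrite -Zgr_eltM ffunE.
Qed.

Lemma Zgr_MzE (f : Zgring gT) (n : int) y : (f *~ n) y = f y * n.
Proof.
have natE m : (f *+ m) y = f y * m%:R.
  by elim: m => [|m IHm]; rewrite ?mulr0 ?mulrS ?ffunE // IHm mulrDr mulr1.
by case: n => n; rewrite ?NegzE ?mulrNz ?ffunE natE ?mulrN natz.
Qed.

End Weight.

(** * Character sums and the cardinality of a formally dual pair *)

Section Duality.

Variables (gT : finGroupType) (G : {group gT}).
Hypothesis abG : abelian G.

(** Column orthogonality, since [Delta] enumerates all linear characters: translating [y] by [z]
    multiplies the sum by [Delta z a], and some [z] makes this factor differ from 1 when [a] is not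
    the identity. *)
Lemma sum_dual_isom (Delta : gT -> 'CF(G)) a :
  dual_isom Delta -> a \in G ->
  \sum_(y in G) Delta y a = if a == 1%g then #|G|%:R else 0.
Proof.
case=> linD morD _ surD Ga; case: eqP => [-> | /eqP nt_a].
  by rewrite -sumr_const; apply: eq_bigr => y /linD/lin_char1.
(* Otherwise [a] would lie in the kernel of every irreducible character, and these kernels meet
   trivially. *)
have [i chia]: exists i : Iirr G, 'chi_i a != 1.
  apply/existsP; apply: contraR nt_a => /existsPn trv.
  suff: a \in \bigcap_i cfker 'chi[G]_i by rewrite TI_cfker_irr inE.
  apply/bigcapP=> i _.
  have lin_i: 'chi_i \is a linear_char by apply/char_abelianP.
  by rewrite cfkerEchar ?irr_char // inE Ga lin_char1 //; apply/negbNE/trv.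
have lin_i: 'chi_i \is a linear_char by apply/char_abelianP.
have [z Gz Dz] := surD _ lin_i.
set s := \sum_(y in G) _.
have: ('chi_i a - 1) * s = 0.
  rewrite mulrBl mul1r; apply/eqP; rewrite subr_eq0; apply/eqP.
  rewrite {2}/s (reindex_inj (mulgI z)) /= mulr_sumr.
  rewrite [RHS](eq_bigl (mem G)) => [|y]; last by rewrite /= groupMl.
  by apply: eq_bigr => y Gy; rewrite morD // cfunE Dz.
by move/eqP; rewrite mulf_eq0 subr_eq0 (negPf chia) => /eqP.
Qed.

(** Parseval: after expanding the squares, orthogonality leaves only the [#|S|] diagonal pairs. *)
Lemma sum_char_sum_norm (Delta : gT -> 'CF(G)) (S : {set gT}) :
  dual_isom Delta -> S \subset G ->
  \sum_(y in G) `|char_sum (Delta y) S| ^+ 2 = (#|G| * #|S|)%:R.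
Proof.
move=> isoD sSG; have [linD _ _ _] := isoD.
have sqE y : y \in G -> `|char_sum (Delta y) S| ^+ 2
    = \sum_(a in S) \sum_(b in S) Delta y (a * b^-1)%g.
  move=> Gy; rewrite normCK [X in X * _]/char_sum mulr_suml; apply: eq_bigr => a Sa.
  rewrite rmorph_sum mulr_sumr; apply: eq_bigr => b Sb.
  have [Ga Gb] : a \in G /\ b \in G by rewrite !(subsetP sSG).
  by rewrite lin_charM ?groupV ?linD // lin_charV_conj ?linD.
rewrite (eq_bigr _ sqE) exchange_big /= mulnC natrM mulr_natl -sumr_const.
apply: eq_bigr => a Sa; rewrite exchange_big /= (bigD1 a) //=.
have sG := subsetP sSG.
rewrite sum_dual_isom ?groupM ?groupV ?sG // mulgV eqxx big1 ?addr0 // => b.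
case/andP=> Sb nba; rewrite sum_dual_isom ?groupM ?groupV ?sG //.
by rewrite -eq_mulgV1 eq_sym (negPf nba).
Qed.

(** Summing the first duality equation over [y] gives [#|G| * #|S|] on the left and
    [#|S| ^ 2 / #|T| * #|T| ^ 2] on the right. *)
Lemma formally_dual_card (Delta : gT -> 'CF(G)) (S T : {set gT}) :
  dual_isom Delta -> formally_dual_pair Delta S T -> S != set0 ->
  #|G| = (#|S| * #|T|)%N.
Proof.
move=> isoD [sSG sTG dual] ntS.
have S_gt0: (0 < #|S|)%N by rewrite card_gt0.
have T_gt0: (0 < #|T|)%N.
  (* For empty [T] the division by 0 yields 0, so the equation at the identity would read
     [#|S| ^ 2 = 0]. *)
  rewrite lt0n; apply/eqP=> T0; have [+ _] := dual 1%g (group1 G).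
  rewrite T0 invr0 mulr0 mul0r => /eqP; rewrite expf_eq0 normr_eq0 /=.
  have [linD morD _ _] := isoD.
  have D1: Delta 1%g = 1.
    apply: (mulrI (lin_char_unitr (linD _ (group1 G)))).
    by rewrite -morD ?mulg1 ?mulr1.
  rewrite /char_sum D1 (eq_bigr (fun=> 1)) => [|a Sa].
    by rewrite sumr_const pnatr_eq0 (gtn_eqF S_gt0).
  by rewrite cfun1E (subsetP sSG).
have := sum_char_sum_norm isoD sSG.
rewrite (eq_bigr (fun y => #|S|%:R ^+ 2 / #|T|%:R * (weight T y)%:R)); last first.
  by move=> y /dual[].
rewrite -mulr_sumr -natr_sum sum_weight // natrX !expr2 mulrA.
rewrite divfK ?pnatr_eq0 -?lt0n // -!natrM => /eqP; rewrite eqr_nat -mulnA.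
by rewrite [X in _ == X]mulnC eqn_pmul2l // => /eqP.
Qed.

End Duality.

(** * Cosets and primitivity *)

(** The argument that a group is not the union of two proper subgroups: if [a * s^-1] lies in [K]
    but not in [H], then for [b * s^-1] in [H] the quotient [b * a^-1] is outside [H], hence in [K],
    which puts [b * s^-1] in [K]. *)
Lemma sub_rcoset_of_quotients (gT : finGroupType) (H K : {group gT})
    (S : {set gT}) (s : gT) :
    s \in S -> {in S &, forall a b, (a * b^-1)%g \in H :|: K} ->
  S \subset H :* s \/ S \subset K :* s.
Proof.
move=> Ss HKS.
have [sH | /subsetPn[a Sa]] := boolP (S \subset H :* s); first by left.
rewrite mem_rcoset => nHa; right; apply/subsetP=> b Sb; rewrite mem_rcoset.
have Ka: (a * s^-1)%g \in K by move: (HKS a s Sa Ss); rewrite inE (negPf nHa).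
have /setUP[Hb|//] := HKS b s Sb Ss.
have ba: (b * a^-1 = (b * s^-1) * (a * s^-1)^-1)%g by rewrite invMg invgK mulgA mulgKV.
have := HKS b a Sb Sa; rewrite ba inE groupMl // groupV (negPf nHa) /=.
by rewrite groupMr // groupV.
Qed.

Lemma primitive_coset_sub (gT : finGroupType) (G H : {group gT}) (S : {set gT}) s :
  primitive_subset G S -> H \subset G -> s \in S -> S \subset H :* s -> H :=: G.
Proof.
case=> sSG nSH _ sHG Ss sSH; apply/eqP/negbNE/negP => neqHG; case: nSH.
exists H; split; first by rewrite properEneq neqHG.
by exists (H :* s) => //; rewrite mem_rcosets mulSGid // (subsetP sSG).
Qed.

Lemma primitive_stable (gT : finGroupType) (G N : {group gT}) (S : {set gT}) :
    primitive_subset G S -> N \subset G ->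
    {in N & S, forall y b, (y * b)%g \in S} ->
  N :=: 1%g.
Proof.
case=> sSG _ nSN sNG NS; apply/eqP/negbNE/negP => ntN; case: nSN.
exists N; split=> //; exists (rcosets N S).
  exact: imsetS.
apply/eqP; rewrite eqEsubset; apply/andP; split; apply/subsetP=> x.
  move=> Sx; apply/bigcupP; exists (N :* x); last exact: rcoset_refl.
  by apply/rcosetsP; exists x.
case/bigcupP=> _ /rcosetsP[b Sb ->] /rcosetP[y Ny ->].
exact: NS.
Qed.

(** * Excluding a weight supported by two subgroups *)

Section RankTwo.

Variables (gT : finGroupType) (G : {group gT}) (S : {set gT}).

(** Counting pairs gives [#|S| ^ 2 = #|S| + #|G|.-1 * lam]. As a divisor of [#|G|], [#|S|] is
    coprime to [#|G|.-1], so it would divide [lam]. *)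
Lemma no_divisible_difference_set (lam t : nat) :
    S \subset G -> #|G| = (#|S| * t)%N ->
    {in G, forall y, y != 1%g -> weight S y = lam} ->
  ~ (0 < lam < #|S|)%N.
Proof.
move=> sSG oG wS /andP[lam_gt0 lt_lam].
have := sum_weight sSG.
rewrite (bigD1 1%g) //= weight1 (eq_bigr (fun=> lam)); last first.
  by move=> y /andP[Gy nty]; rewrite wS.
have ->: (\sum_(y in G | y != 1%g) lam = #|G|.-1 * lam)%N.
  rewrite sum_nat_const; congr (_ * _)%N; rewrite [#|G|](cardsD1 1%g) group1 /=.
  by apply: eq_card => y; rewrite !inE andbC.
move=> ek; have: (#|S| %| #|S| + #|G|.-1 * lam)%N by rewrite ek dvdn_mulr.
rewrite dvdn_addr // Gauss_dvdr; first by move/(dvdn_leq lam_gt0); rewrite leqNgt lt_lam.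
have G_gt0 := cardG_gt0 G.
by rewrite (coprime_dvdl _ (coprimenP G_gt0)) // oG dvdn_mulr.
Qed.

Variables (t : nat) (oG : #|G| = (#|S| * t)%N) (primS : primitive_subset G S).

Lemma no_weight_group_plus_subgroup (H N : {group gT}) (a b : int) :
    S != set0 -> H :=: G -> N \subset G -> 0 < a -> 0 < b ->
    (forall y, (weight S y)%:R = (y \in H)%:R * a + (y \in N)%:R * b) ->
  False.
Proof.
move=> ntS eHG sNG a_gt0 b_gt0 wS; have [sSG _ _] := primS.
have oS: #|S|%:R = a + b by rewrite -weight1 wS !group1 !mul1r.
have N1: N :=: 1%g.
  apply: (primitive_stable primS sNG) => y b' Ny; apply: weight_max.
  by apply/eqP; rewrite -(eqr_nat int) wS oS eHG Ny (subsetP sNG) ?mul1r.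
have aE: a = `|a|%N by rewrite gez0_abs ?ltW.
apply: (no_divisible_difference_set (lam := `|a|%N) sSG oG).
  move=> y Gy nty; apply/eqP; rewrite -(eqr_nat int) wS eHG Gy N1 inE (negPf nty).
  by rewrite mul1r mul0r addr0 natz -aE.
by rewrite -!(ltr_nat int) oS !natz -aE a_gt0 ltrDl.
Qed.

Lemma no_weight_two_subgroups (H K : {group gT}) (a b : int) :
    H \subset G -> K \subset G -> H != K -> S != set0 -> a != 0 -> b != 0 ->
    (forall y, (weight S y)%:R = (y \in H)%:R * a + (y \in K)%:R * b) ->
  False.
Proof.
move=> sHG sKG neHK ntS nza nzb wS.
have oS: #|S|%:R = a + b by rewrite -weight1 wS !group1 !mul1r.
have w_ge0 y : 0 <= (y \in H)%:R * a + (y \in K)%:R * b by rewrite -wS ler0n.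
have w_le y : (y \in H)%:R * a + (y \in K)%:R * b <= a + b.
  by rewrite -wS -oS ler_nat weight_le.
(* At a point of [H] outside [K] the bounds read [0 <= a <= a + b], which settles both signs at
   once; the other case is symmetric. *)
have [a_gt0 b_gt0]: 0 < a /\ 0 < b.
  rewrite !lt_neqAle ![0 == _]eq_sym nza nzb /=.
  move: neHK; rewrite -val_eqE eqEsubset negb_and.
  case/orP=> /subsetPn[y y1 /negPf y2]; move: (w_ge0 y) (w_le y);
    by rewrite y1 y2 mul1r mul0r ?add0r ?addr0 ?lerDl ?lerDr => -> ->.
have [s Ss] := set0Pn _ ntS.
have HKS: {in S &, forall x y, (x * y^-1)%g \in H :|: K}.
  move=> x y Sx Sy; have := weight_gt0 Sx Sy.
  rewrite -(ltr_nat int) wS inE.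
  by case: (_ \in H) (_ \in K) => [] []; rewrite //= !mul0r addr0 ltxx.
have [sSH | sSK] := sub_rcoset_of_quotients Ss HKS.
  have eH := primitive_coset_sub primS sHG Ss sSH.
  exact: (no_weight_group_plus_subgroup ntS eH sKG a_gt0 b_gt0 wS).
have eK := primitive_coset_sub primS sKG Ss sSK.
apply: (no_weight_group_plus_subgroup ntS eK sHG b_gt0 a_gt0) => y.
by rewrite wS addrC.
Qed.

End RankTwo.

Theorem theorem4p17 (gT : finGroupType) (G : {group gT}) (abG : abelian G) :
  ~ exists S : {set gT},
      [/\ primitive_formally_dual_set G S, even_set G S & has_rank G S 2].
Proof.
case=> S [[Delta [T [isoD dual primS _]]] _ [[H [lam [sHG nzl eS]]] minr]].
(* The empty set would have rank 0, by the empty decomposition. *)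
have ntS: S != set0.
  apply/eqP=> S0; suff /minr: even_decomposition G S 0 by [].
  exists (fun=> G), (fun=> 1); split=> //.
  by rewrite big_ord0 S0 /Zgr_set big_set0 mul0r.
pose i0 : 'I_2 := ord0; pose i1 : 'I_2 := ord_max.
have {eS} eS: Zgr_set S * Zgr_setV S
    = Zgr_set (H i0) *~ lam i0 + Zgr_set (H i1) *~ lam i1.
  by rewrite eS big_ord_recl big_ord1; congr (_ + Zgr_set (H _) *~ lam _); apply: val_inj.
have wS y : (weight S y)%:R = (y \in H i0)%:R * lam i0 + (y \in H i1)%:R * lam i1.
  by rewrite -Zgr_set_mulV eS ffunE !Zgr_MzE !Zgr_setE.
(* Equal subgroups would merge into one term, whose coefficient is the weight at the identity,
   [#|S|], hence nonzero. *)
have neH: H i0 != H i1.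
  apply/eqP=> eH; suff /minr: even_decomposition G S 1 by [].
  exists (fun=> H i0), (fun=> lam i0 + lam i1); split=> //.
    move=> _; have := wS 1%g; rewrite weight1 !group1 !mul1r => <-.
    by rewrite pnatr_eq0 cards_eq0.
  by rewrite big_ord1 eS -eH mulrzDr.
exact: (no_weight_two_subgroups (formally_dual_card abG isoD dual ntS) primS
          (sHG i0) (sHG i1) neH ntS (nzl i0) (nzl i1) wS).
Qed.
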